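(* Let $\mathcal{X}$ be a separable topological group, $(\Omega,\mu)$ a measure space, and $\varphi:\mathcal{X}\times\Omega\to\mathbb{C}$ a map such that $\varphi(x,\cdot)$ is in $L_2(\Omega,\mu)$ for every $x\in\mathcal{X}$, while $\varphi(\cdot,\omega)$ is a continuous positive definite function on $\mathcal{X}$ for every $\omega\in\Omega$. Then $$\psi(\cdot)=\int_\Omega\varphi(\cdot,\omega)\,d\mu(\omega)$$ is again a positive definite function on $\mathcal{X}$.
   Context: A function $\varphi:\mathcal{X}\to\mathbb{C}$ on a group $\mathcal{X}$ is called a positive definite function if $H(x,y)=\varphi(xy^{-1})$, $x,y\in\mathcal{X}$, is a reproducing kernel, i.e. if there is a Hilbert space $\mathcal{H}$ of functions $\mathcal{X}\to\mathbb{C}$ with $H(\cdot,y)\in\mathcal{H}$ and $f(y)=\langle f,H(\cdot,y)\rangle$ for all $f\in\mathcal{H}$, $y\in\mathcal{X}$.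
   Formalization: The formal statement adds that φ(x,·) is μ-integrable for every x, so that ψ is defined; for infinite μ, membership in L_2 does not ensure this (φ(x,ω)=c(ω) with c≥0 in L_2 but not in L_1 gives ψ=+∞). *)

(* Defs.v *)
From HB Require Import structures.
From mathcomp Require Import all_boot all_order all_algebra.
From mathcomp Require Import all_classical all_reals all_analysis.
From mathcomp Require Import complex.

Set Implicit Arguments.
Unset Strict Implicit.
Unset Printing Implicit Defensive.

Import Order.TTheory GRing.Theory Num.Theory.
Import numFieldNormedType.Exports.

Local Open Scope classical_set_scope.
Local Open Scope ring_scope.
Local Open Scope complex_scope.

HB.mixin Record isTopologicalGroup G & Topological G & Group G := {
  mulg_continuous : continuous (fun x : G * G => (x.1 * x.2)%g) ;
  invg_continuous : continuous (fun x : G => (x^-1)%g)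
}.

#[short(type="topologicalGroupType")]
HB.structure Definition TopologicalGroup :=
  {G of Topological G & Group G & isTopologicalGroup G}.

Definition separable_space (T : topologicalType) : Prop :=
  exists2 D : set T, countable D & dense D.

Section ReproducingKernel.
Context {R : realType}.

(* {dot H for conjC} is the library's structure of positive definite hermitian
   forms, linear in the first argument; its squared norm is a nonnegative real
   complex number. *)
Definition dot_norm (H : lmodType R[i]) (ip : {dot H for Num.conj}) (f : H) : R :=
  Num.sqrt (complex.Re (ip f f)).

Definition hilbert (H : lmodType R[i]) (ip : {dot H for Num.conj}) : Prop :=
  forall u : nat -> H,
    (forall e : R, 0 < e -> exists N : nat, forall m n : nat,
       (N <= m)%N -> (N <= n)%N -> dot_norm ip (u m - u n) < e) ->
    exists l : H, dot_norm ip (u n - l) @[n --> \oo] --> (0 : R).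

(* H : subLmodType S is the linear subspace S of the space of all functions
   T -> R[i], with pointwise operations. *)
Definition reproducing_kernel (T : Type) (K : T -> T -> R[i]) : Prop :=
  exists (S : {pred T -> R[i]}) (H : subLmodType S) (ip : {dot H for Num.conj}),
    hilbert ip /\
    forall y : T, exists2 k : H,
      \val k = K ^~ y & forall f : H, (\val f : T -> R[i]) y = ip f k.

Definition positive_definite_function (G : groupType) (phi : G -> R[i]) : Prop :=
  reproducing_kernel (fun x y : G => phi (x * y^-1)%g).

End ReproducingKernel.

Section ComplexIntegral.
Context {d : measure_display} {Omega : measurableType d} {R : realType}.
Variable mu : {measure set Omega -> \bar R}.

Definition cmeasurable (f : Omega -> R[i]) : Prop :=
  measurable_fun [set: Omega] (fun w => complex.Re (f w)) /\
  measurable_fun [set: Omega] (fun w => complex.Im (f w)).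

Definition L2 (f : Omega -> R[i]) : Prop :=
  cmeasurable f /\
  (\int[mu]_w ((complex.Re (f w)) ^+ 2 + (complex.Im (f w)) ^+ 2)%:E < +oo)%E.

Definition cintegrable (f : Omega -> R[i]) : Prop :=
  mu.-integrable [set: Omega] (fun w => (complex.Re (f w))%:E) /\
  mu.-integrable [set: Omega] (fun w => (complex.Im (f w))%:E).

Definition cintegral (f : Omega -> R[i]) : R[i] :=
  (\int[mu]_w complex.Re (f w)) +i* (\int[mu]_w complex.Im (f w)).

End ComplexIntegral.

(* Main.v *)
Require Import Defs.
From HB Require Import structures.
From mathcomp Require Import all_boot all_order all_algebra.
From mathcomp Require Import all_classical all_reals all_analysis.
From mathcomp Require Import complex.
From mathcomp Require Import ring lra.
Import Order.TTheory GRing.Theory Num.Theory.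
Import numFieldNormedType.Exports.
Local Open Scope classical_set_scope.
Local Open Scope ring_scope.
Local Open Scope complex_scope.

(** A reproducing kernel is the same thing as a Hermitian kernel all of whose
finite Gram sums have a nonnegative real part, and the latter property passes
through an integral. If K is a reproducing kernel with
representers k_y, then K x y = <k_y, k_x>, so a Gram sum of K is the squared
norm of a linear combination of representers ([reproducing_kernel_psd]). A Gram
sum of the integrated kernel is a finite linear combination of integrals, hence
the integral of the Gram sums of the individual kernels, and is nonnegative
([psd_integral]). It remains to produce a Hilbert space from nonnegativity of
the Gram sums, which is the Moore-Aronszajn theorem ([Moore_Aronszajn]).

That theorem is obtained without completing the span of the functions K(., y).
For a formal combination u of such functions and a vector f of the desired
space, 2 Re <f, u> - |u|^2 = |f|^2 - |f - u|^2, and the left-hand side makes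
sense for an arbitrary function f, since <f, K(., y)> has to be f y. So the
space consists of the functions for which this energy is bounded in u, and the
squared norm is its supremum. The energies satisfy a parallelogram identity,
hence so does the squared norm, and the Jordan-von Neumann theorem
([Jordan_von_Neumann]) provides the inner product. Translating u by a multiple
of K(., y) computes |f + t K(., y)|^2 exactly, which is the reproducing
property ([sqnorm_shift]). Completeness is immediate because a bound on all
energies of F n - F m survives a pointwise limit in m ([sqnorm_complete]). *)

(** * Real and imaginary parts *)

Lemma Re_add (R : realType) (a b : R[i]) :
  complex.Re (a + b) = complex.Re a + complex.Re b.
Proof. by case: a b => [? ?] []. Qed.

Lemma Im_add (R : realType) (a b : R[i]) :
  complex.Im (a + b) = complex.Im a + complex.Im b.
Proof. by case: a b => [? ?] []. Qed.

Lemma Re_mul (R : realType) (a b : R[i]) :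
  complex.Re (a * b) = complex.Re a * complex.Re b - complex.Im a * complex.Im b.
Proof. by case: a b => [? ?] []. Qed.

Lemma Im_mul (R : realType) (a b : R[i]) :
  complex.Im (a * b) = complex.Re a * complex.Im b + complex.Im a * complex.Re b.
Proof. by case: a b => [? ?] []. Qed.

Lemma Re_opp (R : realType) (a : R[i]) : complex.Re (- a) = - complex.Re a.
Proof. by case: a. Qed.

Lemma Re_conj (R : realType) (a : R[i]) : complex.Re a^* = complex.Re a.
Proof. by case: a. Qed.

Lemma Im_conj (R : realType) (a : R[i]) : complex.Im a^* = - complex.Im a.
Proof. by case: a. Qed.

Lemma Re_scale (R : realType) (t : R) (a : R[i]) :
  complex.Re (t%:C * a) = t * complex.Re a.
Proof. by rewrite Re_mul /=; ring. Qed.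

Definition sqmod {R : realType} (a : R[i]) : R :=
  complex.Re a ^+ 2 + complex.Im a ^+ 2.

Lemma sqmod_ge0 (R : realType) (a : R[i]) : 0 <= sqmod a.
Proof. by rewrite addr_ge0 ?sqr_ge0. Qed.

Lemma sqmod0 (R : realType) : sqmod (0 : R[i]) = 0.
Proof. by rewrite /sqmod /= expr0n addr0. Qed.

Lemma sqmodM (R : realType) (a b : R[i]) : sqmod (a * b) = sqmod a * sqmod b.
Proof. by rewrite /sqmod Re_mul Im_mul; ring. Qed.

Lemma sqmodE (R : realType) (a : R[i]) : (sqmod a)%:C = a * a^*.
Proof.
apply/eqP; rewrite eq_complex /sqmod Re_mul Im_mul Re_conj Im_conj /=.
by apply/andP; split; apply/eqP; ring.
Qed.

Lemma sqmod_eq0 (R : realType) (a : R[i]) : sqmod a <= 0 -> a = 0.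
Proof.
move=> a_le0; apply/eqP; rewrite eq_complex -(sqrf_eq0 (complex.Re a)).
rewrite -(sqrf_eq0 (complex.Im a)); move: a_le0; rewrite /sqmod.
have := sqr_ge0 (complex.Re a); have := sqr_ge0 (complex.Im a) => im re le0.
by apply/andP; split; apply/eqP; lra.
Qed.

Lemma sqmodV (R : realType) (a : R[i]) : a != 0 -> sqmod a * sqmod a^-1 = 1.
Proof. by move=> a0; rewrite -sqmodM divff // /sqmod /= expr1n expr0n addr0. Qed.

(** * The Jordan-von Neumann theorem *)

(** The defect [a s - s * a 1] is additive and vanishes on the integers, so it is
bounded on the whole line as soon as it is bounded on [0, 1]; a bounded additive
function is zero. *)
Lemma bounded_additive_linear (R : realType) (a : R -> R) (M : R) :
    {morph a : s t / s + t} -> (forall t, `|t| <= 1 -> `|a t| <= M) ->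
  forall t, a t = t * a 1.
Proof.
move=> aD aM t.
have a0 : a 0 = 0 by have := aD 0 0; rewrite addr0; lra.
have aN s : a (- s) = - a s by have := aD s (- s); rewrite subrr a0; lra.
have aMn s n : a (s *+ n) = a s *+ n.
  by elim: n => [|n ih]; rewrite ?mulr0n // !mulrS aD ih.
have aZ m : a m%:~R = m%:~R * a 1.
  case: m => n; first by rewrite aMn mulr_natl.
  by rewrite NegzE mulrNz aN aMn mulNr mulr_natl.
pose e s := a s - s * a 1.
have eM s : `|e s| <= M + `|a 1|.
  have /andP[fl lf] := Num.Theory.floor_itv s.
  set m := Num.floor s in fl lf.
  have -> : e s = a (s - m%:~R) - (s - m%:~R) * a 1.
    by rewrite /e aD aN aZ; ring.
  have s0 : 0 <= s - m%:~R by rewrite subr_ge0.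
  have s1 : s - m%:~R <= 1 by rewrite intrD in lf; lra.
  apply: le_trans (ler_normB _ _) _; apply: lerD.
    by apply: aM; rewrite ger0_norm.
  by rewrite normrM ler_piMl // ger0_norm.
suff : e t = 0 by rewrite /e; lra.
apply/eqP; apply: contraT; rewrite -normr_gt0 => et.
have := eM (t *+ (Num.bound ((M + `|a 1|) / `|e t|))).
set n := Num.bound _.
have -> : e (t *+ n) = e t *+ n by rewrite /e aMn mulrnAl mulrnBl.
have nb : (M + `|a 1|) / `|e t| < n%:R.
  by apply/archi_boundP/divr_ge0 => //; exact: le_trans (normr_ge0 (e 0)) (eM 0).
by rewrite normrMn -[_ *+ n]mulr_natl leNgt; rewrite ltr_pdivrMr // in nb; rewrite nb.
Qed.

Section JordanVonNeumann.
Context {R : realType} (H : lmodType R[i]) (N : H -> R).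
Hypothesis N_parallelogram :
  forall f g, N (f + g) + N (f - g) = 2 * N f + 2 * N g.
Hypothesis N_homogeneous :
  forall a f, N (a *: f) = sqmod a * N f.
Hypothesis N_ge0 : forall f, 0 <= N f.

(* D is four times the real part of the inner product to be constructed. *)
Let D f g := N (f + g) - N (f - g).

Let NN f : N (- f) = N f.
Proof. by rewrite -scaleN1r N_homogeneous /sqmod /=; ring. Qed.

Let N_sub f g : N (f - g) = N (g - f).
Proof. by rewrite -NN opprB. Qed.

Let D_sym f g : D f g = D g f.
Proof. by rewrite /D N_sub (addrC f). Qed.

Let D0 g : D 0 g = 0.
Proof. by rewrite /D add0r sub0r NN subrr. Qed.

Let D_addl g : {morph D^~ g : f h / f + h}.
Proof.
have step x y : D (x + y) g + D (x - y) g = 2 * D x g.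
  have := N_parallelogram (x + g) y; have := N_parallelogram (x - g) y.
  by rewrite /D !(addrAC _ _ y) !(addrAC _ _ (- y)); lra.
have dbl x : D (x + x) g = 2 * D x g by rewrite -(step x x) subrr D0 addr0.
move=> f h /=.
pose x := 2^-1 *: (f + h); pose y := 2^-1 *: (f - h).
have half (z : H) : 2^-1 *: z + 2^-1 *: z = z.
  by rewrite -scalerDl -[RHS]scale1r; congr (_ *: _); field.
have xyf : x + y = f.
  by rewrite /x /y -scalerDr addrACA subrr addr0 scalerDr half.
have xyh : x - y = h.
  by rewrite /x /y -scalerBr opprB addrC addrA subrK scalerDr half.
by rewrite -[X in _ = D X _ + _]xyf -[X in _ = _ + D X _]xyh step -dbl half.
Qed.

(* For t in [-1, 1] the parallelogram law bounds D (t f) g by 2 N f + 2 N g, so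
   additivity in f already forces homogeneity over the reals. *)
Let D_scalel (t : R) f g : D (t%:C *: f) g = t * D f g.
Proof.
have := @bounded_additive_linear R (fun t => D (t%:C *: f) g) (2 * N f + 2 * N g).
move=> /(_ _ _ t) /=; rewrite scale1r; apply.
  by move=> s r; rewrite rmorphD scalerDl D_addl.
move=> {}t t1; rewrite /D.
have := N_parallelogram (t%:C *: f) g.
have : N (t%:C *: f) <= N f.
  rewrite N_homogeneous /sqmod /= expr0n /= addr0 ler_piMl //.
  by rewrite -real_normK ?num_real // expr_le1.
have := N_ge0 (t%:C *: f + g); have := N_ge0 (t%:C *: f - g).
by rewrite ler_norml; lra.
Qed.

Let D_i f g : D ('i *: f) ('i *: g) = D f g.
Proof. by rewrite /D -scalerDr -scalerBr !N_homogeneous /sqmod /=; ring. Qed.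

Let ii (f : H) : 'i *: ('i *: f) = - f.
Proof. by rewrite scalerA -expr2 sqr_i scaleN1r. Qed.

Let D_oppl f g : D (- f) g = - D f g.
Proof. by have := D_addl g f (- f); rewrite subrr D0; lra. Qed.

(** The imaginary part comes from Im <f, g> = Re <f, i g>, the form being
conjugate-linear in the second argument. *)
Definition polarization f g : R[i] := (D f g / 4) +i* (D f ('i *: g) / 4).

Let pol_herm f g : polarization f g = (-1) ^+ false * Num.conj (polarization g f).
Proof.
rewrite expr0 mul1r -[Num.conj _]/(conjc _) /polarization /=.
rewrite (D_sym g f); congr (_ +i* _).
by rewrite (D_sym g) -(D_i f) ii D_sym D_oppl D_sym mulNr.
Qed.

Let pol_linearl g : GRing.linear_for ( *%R : R[i] -> R[i] -> R[i]) (polarization^~ g).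
Proof.
have pold f h : polarization (f + h) g = polarization f g + polarization h g.
  by rewrite /polarization !D_addl !mulrDl.
move=> [s t] f h; rewrite pold; congr (_ + _).
have -> : (s +i* t) *: f = s%:C *: f + t%:C *: ('i *: f).
  rewrite scalerA -scalerDl; congr (_ *: _).
  by apply/eqP; rewrite eq_complex /= !(mulr0, mulr1, mul0r, subr0, addr0, add0r) !eqxx.
rewrite pold /polarization.
rewrite !D_scalel D_i.
have -> : D ('i *: f) g = - D f ('i *: g) by rewrite -(D_i ('i *: f)) ii D_oppl.
by apply/eqP; rewrite eq_complex /=; apply/andP; split; apply/eqP; ring.
Qed.

(** Only the real part of the form is described: it determines the form, because
Im <f, g> = - Re <i f, g>. *)
Lemma Jordan_von_Neumann (N_eq0 : forall f, N f = 0 -> f = 0) :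
  exists ip : {dot H for Num.conj},
    forall f g, complex.Re (ip f g) = (N (f + g) - N (f - g)) / 4.
Proof.
have pol_bil : bilinear_for ( *%R : R[i] -> R[i] -> R[i]) (Num.conj \; *%R) polarization.
  split=> [g|f]; first exact: pol_linearl.
  move=> a g h /=; rewrite pol_herm [in RHS]pol_herm (pol_herm f h).
  by rewrite !expr0 !mul1r pol_linearl rmorphD rmorphM.
have pol_pos f : f != 0 -> 0 < polarization f f.
  move=> f0.
  have -> : polarization f f = (N f)%:C.
    have N0 : N 0 = 0 by rewrite -(scale0r 0) N_homogeneous /sqmod /=; ring.
    have Dff : D f f = 4 * N f.
      by have := N_parallelogram f f; rewrite /D subrr N0; lra.
    have Dfif : D f ('i *: f) = 0.
      have := D_oppl f ('i *: f).
      by rewrite -[X in D X _ = _]ii D_i D_sym; lra.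
    by rewrite /polarization Dff Dfif mul0r mulrC mulKf // pnatr_eq0.
  rewrite ltcR lt_neqAle N_ge0 andbT eq_sym; apply: contra f0 => /eqP /N_eq0 ->.
  by rewrite eqxx.
pose b := bilinear_isBilinear.Build _ _ _ _ _ _ polarization pol_bil.
pose h := isHermitianSesquilinear.Build _ _ false Num.conj polarization pol_herm.
pose p := isDotProduct.Build _ _ polarization pol_pos.
pose ip : {dot H for Num.conj} := HB.pack polarization b h p.
by exists ip.
Qed.
End JordanVonNeumann.

(** * Formal combinations of kernel functions *)

Section KernelCombinations.
Context {R : realType} {T : Type}.
Local Notation C := (R[i]).
Implicit Types (f g : T -> C) (u v w : seq (C * T)) (a : C).

(** The list u stands for the combination of the functions K(., x) with
coefficient a, over the entries (a, x) of u. Then [pairing f u] is what the inner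
product <f, u> has to be when f y = <f, K(., y)>. *)
Definition pairing f u : C := \sum_(p <- u) p.1^* * f p.2.

Definition scale_comb a u : seq (C * T) := [seq (a * p.1, p.2) | p <- u].

Lemma pairing_nil f : pairing f [::] = 0.
Proof. exact: big_nil. Qed.

Lemma pairing1 f a x : pairing f [:: (a, x)] = a^* * f x.
Proof. exact: big_seq1. Qed.

Lemma pairing_cat f u v : pairing f (u ++ v) = pairing f u + pairing f v.
Proof. exact: big_cat. Qed.

Lemma pairing_scale f a u : pairing f (scale_comb a u) = a^* * pairing f u.
Proof.
rewrite /pairing big_map mulr_sumr; apply: eq_bigr => p _ /=.
by rewrite rmorphM mulrA.
Qed.

Lemma pairingD f g u : pairing (f + g) u = pairing f u + pairing g u.
Proof.
by rewrite -big_split; apply: eq_bigr => p _ /=; rewrite -mulrDr.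
Qed.

Lemma pairingZ a f u : pairing (a *: f) u = a * pairing f u.
Proof. by rewrite mulr_sumr; apply: eq_bigr => p _; rewrite mulrCA. Qed.

Lemma pairingN f u : pairing (- f) u = - pairing f u.
Proof. by rewrite -scaleN1r pairingZ mulN1r. Qed.

Lemma pairing0 u : pairing 0 u = 0.
Proof. by apply: big1 => p _; rewrite mulr0. Qed.

Variable K : T -> T -> C.

(** The inner product <u, v> of two combinations, forced by
<K(., y), K(., x)> = K x y. *)
Definition gram u v : C := \sum_(p <- u) p.1 * pairing (K^~ p.2) v.

Lemma gram_catl u v w : gram (u ++ v) w = gram u w + gram v w.
Proof. exact: big_cat. Qed.

Lemma gram_catr u v w : gram u (v ++ w) = gram u v + gram u w.
Proof.
by rewrite -big_split; apply: eq_bigr => p _; rewrite pairing_cat mulrDr.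
Qed.

Lemma gram_scalel a u v : gram (scale_comb a u) v = a * gram u v.
Proof.
rewrite /gram big_map mulr_sumr; apply: eq_bigr => p _ /=.
by rewrite mulrA.
Qed.

Lemma gram_scaler a u v : gram u (scale_comb a v) = a^* * gram u v.
Proof.
rewrite mulr_sumr; apply: eq_bigr => p _.
by rewrite pairing_scale mulrCA.
Qed.

Lemma pairing_kernel y u : pairing (K^~ y) u = gram [:: (1, y)] u.
Proof. by rewrite /gram big_seq1 mul1r. Qed.

Lemma gram_conj (K_herm : forall x y, K x y = (K y x)^*) u v :
  gram u v = (gram v u)^*.
Proof.
rewrite /gram rmorph_sum /=.
under eq_bigr do rewrite mulr_sumr.
rewrite exchange_big /=; apply: eq_bigr => q _.
rewrite rmorphM rmorph_sum mulr_sumr; apply: eq_bigr => p _ /=.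
by rewrite rmorphM /= conjcK K_herm; ring.
Qed.

(** Gram sums of a Hermitian kernel are real, so bounding their real part is
enough. *)
Definition positive_semidefinite : Prop :=
  (forall x y, K x y = (K y x)^*) /\ forall u, 0 <= complex.Re (gram u u).

End KernelCombinations.

(** * The Moore-Aronszajn theorem *)

Lemma cauchy_cvgn (R : realType) (v : nat -> R) :
    (forall e, 0 < e -> exists n0, forall m n, (n0 <= m)%N -> (n0 <= n)%N ->
      `|v m - v n| < e) ->
  cvgn v.
Proof.
move=> v_cauchy; apply/cauchy_cvgP/cauchy_exP => e /v_cauchy[n0 h].
by exists (v n0), n0 => // n /= le_n; exact: h.
Qed.

Section MooreAronszajn.
Context {R : realType} {T : Type} (K : T -> T -> R[i]).
Hypothesis K_psd : positive_semidefinite K.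
Local Notation C := (R[i]).
Implicit Types (f g : T -> C) (u v w : seq (C * T)) (a : C).
Local Notation Re := (@complex.Re R).
Local Notation Im := (@complex.Im R).

(** In the Hilbert space to be constructed this is |f|^2 - |f - u|^2. *)
Definition energy f u : R := 2 * Re (pairing f u) - Re (gram K u u).

Definition finite_energy f : Prop := exists M : R, forall u, energy f u <= M.

Definition sqnorm f : R := sup (range (energy f)).

Let gram_sym u v : Re (gram K u v) = Re (gram K v u).
Proof. by rewrite (gram_conj K K_psd.1) Re_conj. Qed.

Lemma energy_le_sqnorm f u : finite_energy f -> energy f u <= sqnorm f.
Proof.
move=> [M fM]; apply: ub_le_sup; last by exists u.
by exists M => _ [v _ <-].
Qed.

Lemma sqnorm_le f M : (forall u, energy f u <= M) -> sqnorm f <= M.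
Proof.
move=> fM; apply: ge_sup; first by exists (energy f [::]), [::].
by move=> _ [v _ <-].
Qed.

Lemma energy_nil f : energy f [::] = 0.
Proof. by rewrite /energy pairing_nil /gram big_nil /=; ring. Qed.

Lemma sqnorm_ge0 f : finite_energy f -> 0 <= sqnorm f.
Proof. by move=> fin; rewrite -(energy_nil f) energy_le_sqnorm. Qed.

Lemma energy0_le u : energy 0 u <= 0.
Proof. by rewrite /energy pairing0 /= mulr0 sub0r oppr_le0; exact: K_psd.2. Qed.

Lemma finite_energy0 : finite_energy 0.
Proof. by exists 0; exact: energy0_le. Qed.

Lemma sqnorm0 : sqnorm 0 = 0.
Proof.
apply: le_anti; rewrite sqnorm_ge0 ?andbT; last exact: finite_energy0.
exact/sqnorm_le/energy0_le.
Qed.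

(** The combinations on the right are (u + v) / 2 and (u - v) / 2: both the pairing
terms and, by the parallelogram identity for the Gram form, the quadratic terms
match. *)
Lemma energy_parallelogram f g u v :
  energy (f + g) u + energy (f - g) v =
  2 * energy f (scale_comb (2^-1)%:C (u ++ v)) +
  2 * energy g (scale_comb (2^-1)%:C (u ++ scale_comb (-1)%:C v)).
Proof.
rewrite /energy !(gram_scalel, gram_scaler, gram_catl, gram_catr).
rewrite !(pairing_scale, pairing_cat, pairingD, pairingN).
rewrite !(Re_mul, Re_add, Re_opp, Re_conj, Im_conj) /= (gram_sym v u).
by field.
Qed.

Let le_parallelogram f g u v : finite_energy f -> finite_energy g ->
  energy (f + g) u + energy (f - g) v <= 2 * sqnorm f + 2 * sqnorm g.
Proof.
move=> ff fg; rewrite energy_parallelogram.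
by apply: lerD; rewrite ler_pM2l //; exact: energy_le_sqnorm.
Qed.

Lemma finite_energyD f g :
  finite_energy f -> finite_energy g -> finite_energy (f + g).
Proof.
move=> ff fg; exists (2 * sqnorm f + 2 * sqnorm g) => u.
have := @le_parallelogram f g u [::] ff fg.
by rewrite energy_nil addr0.
Qed.

Lemma energyZ a f u : a != 0 ->
  energy (a *: f) u = sqmod a * energy f (scale_comb a^-1 u).
Proof.
move=> a0; rewrite /energy pairingZ pairing_scale gram_scalel gram_scaler.
have -> : a * pairing f u = (sqmod a)%:C * ((a^-1)^* * pairing f u).
  rewrite sqmodE mulrA; congr (_ * _).
  by rewrite -mulrA -rmorphM divff // rmorph1 mulr1.
rewrite Re_scale [a^-1 * _]mulrA -sqmodE Re_scale mulrBr [X in _ = _ - X]mulrA.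
by rewrite sqmodV // mul1r mulrCA.
Qed.

Let energyZ_le a f u : finite_energy f ->
  energy (a *: f) u <= sqmod a * sqnorm f.
Proof.
move=> ff; have [->|a0] := eqVneq a 0.
  by rewrite scale0r sqmod0 mul0r; exact: energy0_le.
by rewrite energyZ // ler_wpM2l ?sqmod_ge0 // energy_le_sqnorm.
Qed.

Lemma finite_energyZ a f : finite_energy f -> finite_energy (a *: f).
Proof.
by move=> ff; eexists => u; exact: energyZ_le.
Qed.

Let finite_energyB f g :
  finite_energy f -> finite_energy g -> finite_energy (f - g).
Proof.
move=> ff fg; apply: finite_energyD => //; rewrite -scaleN1r.
exact: finite_energyZ.
Qed.

Lemma sqnormZ a f : finite_energy f ->
  sqnorm (a *: f) = sqmod a * sqnorm f.
Proof.
move=> ff; apply: le_anti; apply/andP; split.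
  by apply: sqnorm_le => u; exact: energyZ_le.
have [->|a0] := eqVneq a 0.
  by rewrite scale0r sqnorm0 sqmod0 mul0r.
have h : sqnorm f <= sqmod a^-1 * sqnorm (a *: f).
  rewrite -[X in sqnorm X <= _]scale1r -(mulVf a0) -scalerA.
  by apply: sqnorm_le => u; exact/energyZ_le/finite_energyZ.
apply: le_trans (ler_wpM2l (sqmod_ge0 R a) h) _.
by rewrite mulrA sqmodV // mul1r.
Qed.

(** Each side of the parallelogram law dominates the other: one inequality comes
from [energy_parallelogram], and applying it to f + g and f - g gives the
reverse one. *)
Lemma sqnorm_parallelogram f g : finite_energy f -> finite_energy g ->
  sqnorm (f + g) + sqnorm (f - g) = 2 * sqnorm f + 2 * sqnorm g.
Proof.
have le_side h k : finite_energy h -> finite_energy k ->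
    sqnorm (h + k) + sqnorm (h - k) <= 2 * sqnorm h + 2 * sqnorm k.
  move=> fh fk; rewrite -lerBrDr; apply: sqnorm_le => u.
  rewrite lerBrDl -lerBrDr; apply: sqnorm_le => v.
  by rewrite lerBrDr addrC; exact: le_parallelogram.
move=> ff fg; apply: le_anti; rewrite le_side //=.
have := le_side (f + g) (f - g) (finite_energyD f g ff fg) (finite_energyB f g ff fg).
have dbl h : finite_energy h -> sqnorm (h + h) = 4 * sqnorm h.
  by move=> fh; rewrite -mulr2n -scaler_nat sqnormZ // /sqmod /=; ring.
rewrite [X in sqnorm X + _](_ : _ = f + f); last by rewrite addrACA subrr addr0.
rewrite [X in _ + sqnorm X](_ : _ = g + g); last first.
  by rewrite opprB addrC addrA subrK.
by rewrite !dbl //; lra.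
Qed.

(** Convergence in norm implies pointwise convergence. *)
Lemma sqmod_point_le f x : finite_energy f ->
  sqmod (f x) <= (Re (K x x) + 1) * sqnorm f.
Proof.
move=> ff; set k := Re (K x x).
have k0 : 0 <= k.
  have := K_psd.2 [:: (1, x)].
  by rewrite /gram big_seq1 pairing1 /= !(Re_mul, Re_conj, Im_conj) /= -/k; lra.
(* The energy along s f x K(., x) is (2 s - s^2 k) |f x|^2. It is maximal at
   s = 1 / k; the choice s = 1 / (k + 1) also covers k = 0. *)
set s := (k + 1)^-1.
have sk : s * k = 1 - s by rewrite -[in RHS](mulVf (_ : k + 1 != 0)) -/s; lra.
have := energy_le_sqnorm f [:: (s%:C * f x, x)] ff.
have -> : energy f [:: (s%:C * f x, x)] = s * sqmod (f x) + s ^+ 2 * sqmod (f x).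
  transitivity (2 * s * sqmod (f x) - s * (s * k) * sqmod (f x)).
    rewrite /energy /gram big_seq1 !pairing1 /= /sqmod.
    by rewrite !(Re_mul, Im_mul, Re_conj, Im_conj) /= -/k; ring.
  by rewrite sk; ring.
have := mulr_ge0 (sqr_ge0 s) (sqmod_ge0 R (f x)) => ge0 le_sup.
by rewrite mulrC -ler_pdivrMr -/s; lra.
Qed.

Lemma sqnorm_eq0 f : finite_energy f -> sqnorm f = 0 -> f = 0.
Proof.
move=> ff f0; apply/funext => x; apply: sqmod_eq0.
by have := sqmod_point_le f x ff; rewrite f0 mulr0.
Qed.

(* The pairing of K(., y) with u is its Gram product with u, so adding t K(., y)
   to f cancels the cross terms created by adding it to u. *)
Let energy_shift (t : R) f y u :
  energy (f + t%:C *: K^~ y) ((t%:C, y) :: u) =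
  energy f u + 2 * t * Re (f y) + t ^+ 2 * Re (K y y).
Proof.
rewrite -cat1s /energy gram_catl !gram_catr pairing_cat !pairingD !pairingZ.
rewrite !pairing_kernel !Re_add (gram_sym u [:: _]).
have -> v : gram K [:: (t%:C, y)] v = t%:C * gram K [:: (1, y)] v.
  by rewrite /gram !big_seq1 mul1r.
rewrite !pairing1 !(Re_mul, Re_conj, Im_conj, Re_add).
rewrite /gram !big_seq1 pairing1 !(Re_mul, Re_conj, Im_conj, Re_add) /=.
by ring.
Qed.

Let energy_shift_back (t : R) f y u :
  energy (f + t%:C *: K^~ y) u =
  energy f (((- t)%:C, y) :: u) + 2 * t * Re (f y) + t ^+ 2 * Re (K y y).
Proof.
have := energy_shift (- t) (f + t%:C *: K^~ y) y u.
rewrite -addrA -scalerDl -rmorphD subrr scale0r addr0 => ->.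
by rewrite Re_add /= Re_mul /=; ring.
Qed.

Lemma finite_energy_kernel y : finite_energy (K^~ y).
Proof.
exists (Re (K y y)) => u.
have := energy_shift_back 1 0 y u.
rewrite scale1r add0r => ->.
by have := energy0_le (((- 1)%:C, y) :: u); rewrite /=; lra.
Qed.

(** The expansion of |f + t K(., y)|^2 in which the cross term is 2 t Re (f y): this
is the real part of the reproducing property. *)
Lemma sqnorm_shift (t : R) f y : finite_energy f ->
  sqnorm (f + t%:C *: K^~ y) = sqnorm f + 2 * t * Re (f y) + t ^+ 2 * Re (K y y).
Proof.
move=> ff; have fk := finite_energyD f _ ff (finite_energyZ t%:C _ (finite_energy_kernel y)).
apply: le_anti; apply/andP; split.
  by apply: sqnorm_le => u; rewrite energy_shift_back !lerD2r energy_le_sqnorm.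
rewrite -addrA -lerBrDr; apply: sqnorm_le => u.
by rewrite lerBrDr addrA -energy_shift energy_le_sqnorm.
Qed.

Let pairing_cvg (F : nat -> T -> C) (l : T -> C) :
    (forall x, Re (F n x) @[n --> \oo] --> Re (l x)) ->
    (forall x, Im (F n x) @[n --> \oo] --> Im (l x)) ->
  forall u, Re (pairing (F n) u) @[n --> \oo] --> Re (pairing l u).
Proof.
move=> FRe FIm; elim=> [|[a x] u ih].
  by rewrite pairing_nil; under eq_fun do rewrite pairing_nil; exact: cvg_cst.
have pc f : Re (pairing f ((a, x) :: u)) =
    Re a * Re (f x) + Im a * Im (f x) + Re (pairing f u).
  by rewrite /pairing big_cons /= Re_add Re_mul Re_conj Im_conj; ring.
rewrite pc; under eq_fun do rewrite pc.
by apply: cvgD ih; apply: cvgD; apply: cvgMr.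
Qed.

(** A Cauchy sequence converges pointwise; each energy depends on finitely many
values, so a bound on the energies of F n - F m is inherited by F n - l when m
tends to infinity. *)
Lemma sqnorm_complete (F : nat -> T -> C) :
    (forall n, finite_energy (F n)) ->
    (forall e : R, 0 < e -> exists n0, forall m n, (n0 <= m)%N -> (n0 <= n)%N ->
      sqnorm (F m - F n) < e) ->
  exists2 l : T -> C, finite_energy l & forall e : R, 0 < e ->
    exists n0, forall n, (n0 <= n)%N -> sqnorm (F n - l) <= e.
Proof.
move=> F_fin F_cauchy.
(* part is the real or the imaginary part *)
have point (part : C -> R) : {morph part : a b / a - b} ->
    (forall a, part a ^+ 2 <= sqmod a) ->
    forall x, cvgn (fun n => part (F n x)).
  move=> partB part_le x; apply: cauchy_cvgn => e e0.
  have k0 : 0 < `|Re (K x x)| + 1 by apply: ltr_wpDl.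
  have [n0 h] := F_cauchy (e ^+ 2 / (`|Re (K x x)| + 1)) (divr_gt0 (exprn_gt0 2 e0) k0).
  exists n0 => m n le_m le_n.
  rewrite -(@ltr_pXn2r _ 2) ?nnegrE ?(ltW e0) // real_normK ?num_real // -partB.
  apply: le_lt_trans (part_le _) _.
  have := sqmod_point_le _ x (finite_energyB _ _ (F_fin m) (F_fin n)).
  have := h m n le_m le_n; rewrite ltr_pdivlMr // => lt1 le1.
  apply: le_lt_trans le1 (le_lt_trans _ lt1).
  rewrite mulrC ler_wpM2l ?sqnorm_ge0 ?lerD2r ?ler_norm //.
  exact: finite_energyB.
have cRe : forall x, cvgn (fun n => Re (F n x)).
  by apply: point => [[? ?] [? ?]|[p q]] //=; rewrite /sqmod lerDl sqr_ge0.
have cIm : forall x, cvgn (fun n => Im (F n x)).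
  by apply: point => [[? ?] [? ?]|[p q]] //=; rewrite /sqmod lerDr sqr_ge0.
pose l x : C := limn (fun n => Re (F n x)) +i* limn (fun n => Im (F n x)).
have lim_energy n u : energy (F n - F m) u @[m --> \oo] --> energy (F n - l) u.
  rewrite /energy pairingD pairingN Re_add Re_opp.
  under eq_fun do rewrite pairingD pairingN Re_add Re_opp.
  apply: cvgB; last exact: cvg_cst.
  apply: cvgMr; apply: cvgB; first exact: cvg_cst.
  by apply: pairing_cvg => x; [exact: cRe|exact: cIm].
have close e : 0 < e -> exists n0, forall n, (n0 <= n)%N ->
    forall u, energy (F n - l) u <= e.
  move=> /F_cauchy[n0 h]; exists n0 => n le_n u.
  rewrite -(cvg_lim _ (lim_energy n u)) //.
  apply: limr_le; first exact: cvgP (lim_energy n u).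
  exists n0 => // m /= le_m; apply: le_trans (ltW (h n m le_n le_m)).
  exact/energy_le_sqnorm/finite_energyB.
exists l.
  have [n0 /(_ n0 (leqnn _)) h] := close 1 ltr01.
  have -> : l = F n0 - (F n0 - l) by rewrite opprB addrCA subrr addr0.
  by apply: finite_energyB => //; exists 1.
move=> e /close[n0 h]; exists n0 => n le_n; apply: sqnorm_le => u; exact: h.
Qed.

Definition native_space : {pred T -> C} := fun f => `[< finite_energy f >].

Lemma native_space_submod_closed : submod_closed native_space.
Proof.
split=> [|a f g /asboolP ff /asboolP fg]; apply/asboolP.
  exact: finite_energy0.
by apply: finite_energyD => //; exact: finite_energyZ.
Qed.

HB.instance Definition _ :=
  GRing.isSubmodClosed.Build _ _ native_space native_space_submod_closed.

Record native := Native {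
  native_fun : T -> C;
  native_mem : native_fun \in native_space }.

HB.instance Definition _ := [isSub for native_fun].
HB.instance Definition _ := [Choice of native by <:].
HB.instance Definition _ := [SubChoice_isSubLmodule of native by <:].

Theorem Moore_Aronszajn : reproducing_kernel K.
Proof.
have fin (f : native) : finite_energy (val f) by apply/asboolP; exact: native_mem.
pose N (f : native) := sqnorm (val f).
have N_par (f g : native) : N (f + g) + N (f - g) = 2 * N f + 2 * N g.
  by rewrite /N raddfD raddfB; exact: sqnorm_parallelogram (fin f) (fin g).
have N_hom a (f : native) : N (a *: f) = sqmod a * N f.
  by rewrite /N linearZ; exact: sqnormZ (fin f).
have N_ge0 (f : native) : 0 <= N f by exact: sqnorm_ge0.
have N_eq0 (f : native) : N f = 0 -> f = 0.
  by move=> /(sqnorm_eq0 _ (fin f)) f0; apply: val_inj; rewrite f0 raddf0.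
have [ip ipE] := Jordan_von_Neumann _ N N_par N_hom N_ge0 N_eq0.
have norm_ip (f : native) : dot_norm ip f = Num.sqrt (N f).
  rewrite /dot_norm ipE; congr Num.sqrt; have := N_par f f.
  by rewrite subrr (_ : N 0 = 0) ?/N ?raddf0 ?sqnorm0 //; lra.
exists native_space, native, ip; split.
  move=> F F_cauchy.
  have [//|e e0|l l_fin Fl] := sqnorm_complete (fun n => val (F n)).
    have [|n0 h] := F_cauchy (Num.sqrt e); first by rewrite sqrtr_gt0.
    exists n0 => m n le_m le_n; have := h m n le_m le_n.
    by rewrite norm_ip ltr_sqrt // /N raddfB.
  have l_mem : l \in native_space by exact/asboolP.
  exists (Native _ l_mem); apply/cvgrPdist_le => e e0.
  have [n0 h] := Fl (e ^+ 2) (exprn_gt0 2 e0).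
  exists n0 => // n /= le_n; rewrite sub0r normrN ger0_norm ?sqrtr_ge0 //.
  rewrite norm_ip -(ger0_norm (ltW e0)) -sqrtr_sqr ler_wsqrtr //.
  by rewrite /N raddfB; exact: h.
move=> y.
have k_mem : K^~ y \in native_space by apply/asboolP; exact: finite_energy_kernel.
exists (Native _ k_mem) => // f; set k := Native _ _.
(* [sqnorm_shift] at t = 1 and t = -1 computes the polarization formula *)
have Re_repr (h : native) : Re (val h y) = Re (ip h k).
  rewrite ipE /N.
  have := sqnorm_shift 1 _ y (fin h); have := sqnorm_shift (-1) _ y (fin h).
  rewrite rmorphN rmorph1 scaleN1r scale1r raddfD raddfB /=.
  by move=> -> ->; lra.
apply/eqP; rewrite eq_complex Re_repr eqxx /=.
(* multiplying by 'i turns imaginary parts into real ones *)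
have := Re_repr ('i *: f); rewrite linearZl_LR linearZ /= !Re_mul /=.
by move=> h; apply/eqP; lra.
Qed.
End MooreAronszajn.

(** * Gram sums of reproducing kernels and of integrals of kernels *)

(** The Gram sum of K along u is the squared norm of the combination of
representers with the coefficients of u. *)
Lemma reproducing_kernel_psd (R : realType) (T : Type) (K : T -> T -> R[i]) :
  reproducing_kernel K -> positive_semidefinite K.
Proof.
move=> [S [H [ip [_ K_repr]]]].
have /choice[k kP] : forall y, exists k : H, \val k = K^~ y /\
    forall f : H, (\val f : T -> R[i]) y = ip f k.
  by move=> y; have [k] := K_repr y; exists k.
have KE x y : K x y = ip (k y) (k x) by rewrite -(kP x).2 (kP y).1.
split=> [x y|u].
  by rewrite !KE hermitian_subproof expr0 mul1r.
have -> : gram K u u =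
    ip (\sum_(p <- u) p.1 *: k p.2) (\sum_(p <- u) p.1 *: k p.2).
  rewrite linear_sumlz; apply: eq_bigr => p _.
  rewrite linearZl_LR (linear_sumr ip); congr (_ * _); apply: eq_bigr => q _.
  by rewrite linearZr_LR KE.
by have := dnorm_ge0 ip (\sum_(p <- u) p.1 *: k p.2); rewrite lecE => /andP[].
Qed.

Section IntegralOfKernels.
Context {d : measure_display} {Omega : measurableType d} {R : realType}.
Variable mu : {measure set Omega -> \bar R}.
Local Notation Re := (@complex.Re R).
Local Notation Im := (@complex.Im R).

Let integrable_comb (a b : R) (f g : Omega -> R) :
  mu.-integrable setT (EFin \o f) -> mu.-integrable setT (EFin \o g) ->
  mu.-integrable setT (EFin \o (fun w => a * f w + b * g w)).
Proof.
move=> fi gi; rewrite [X in integrable _ _ X](_ : _ =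
    (fun w => (a%:E * (f w)%:E)%E) \+ (fun w => (b%:E * (g w)%:E)%E))%E //.
by apply: integrableD => //; exact: integrableZl.
Qed.

Let Rintegral_comb (a b : R) (f g : Omega -> R) :
  mu.-integrable setT (EFin \o f) -> mu.-integrable setT (EFin \o g) ->
  \int[mu]_w (a * f w + b * g w) = a * \int[mu]_w f w + b * \int[mu]_w g w.
Proof.
move=> fi gi; rewrite RintegralD //; last 2 first.
- exact: (integrableZl _ a fi).
- exact: (integrableZl _ b gi).
by rewrite !RintegralZl.
Qed.

Lemma cintegral_scale_add (a : R[i]) (f g : Omega -> R[i]) :
  cintegrable mu f -> cintegrable mu g ->
  cintegrable mu (fun w => a * f w + g w) /\
  cintegral mu (fun w => a * f w + g w) = a * cintegral mu f + cintegral mu g.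
Proof.
move=> [fRe fIm] [gRe gIm].
have ReE w : Re (a * f w + g w) =
    1 * (Re a * Re (f w) + (- Im a) * Im (f w)) + 1 * Re (g w).
  by rewrite Re_add Re_mul; ring.
have ImE w : Im (a * f w + g w) =
    1 * (Im a * Re (f w) + Re a * Im (f w)) + 1 * Im (g w).
  by rewrite Im_add Im_mul; ring.
split.
  split.
    under eq_fun do rewrite ReE.
    by apply: integrable_comb => //; exact: integrable_comb.
  under eq_fun do rewrite ImE.
  by apply: integrable_comb => //; exact: integrable_comb.
rewrite /cintegral.
under eq_Rintegral do rewrite ReE.
under [X in _ +i* X]eq_Rintegral do rewrite ImE.
rewrite !Rintegral_comb //; try exact: integrable_comb.
by apply/eqP; rewrite eq_complex Re_add Re_mul /=; apply/andP; split; apply/eqP;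
  case: (a) => ? ? /=; ring.
Qed.

Lemma cintegral_sum (I : Type) (s : seq I) (c : I -> R[i]) (F : I -> Omega -> R[i]) :
  (forall i, cintegrable mu (F i)) ->
  cintegrable mu (fun w => \sum_(i <- s) c i * F i w) /\
  cintegral mu (fun w => \sum_(i <- s) c i * F i w) =
    \sum_(i <- s) c i * cintegral mu (F i).
Proof.
move=> Fi; elim: s => [|i s [ih1 ih2]].
  under eq_fun do rewrite big_nil; rewrite big_nil; split.
    by split; exact: integrable0.
  by apply/eqP; rewrite eq_complex /= !Rintegral_cst // !mul0r !eqxx.
under eq_fun do rewrite big_cons; rewrite big_cons.
by rewrite -ih2; exact: cintegral_scale_add.
Qed.

(** By linearity, the Gram sum of the integrated kernel is the integral of the Gram
sums, and an integral of nonnegative functions is nonnegative. *)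
Lemma psd_integral (T : Type) (K : T -> T -> Omega -> R[i]) :
  (forall x y, cintegrable mu (K x y)) ->
  (forall w, positive_semidefinite (fun x y => K x y w)) ->
  positive_semidefinite (fun x y => cintegral mu (K x y)).
Proof.
move=> Ki K_psd; split=> [x y|u].
  rewrite /cintegral /=; congr (_ +i* _).
    by apply: eq_Rintegral => w _; rewrite (K_psd w).1 Re_conj.
  rewrite -mulN1r -RintegralZl //; last by case: (Ki y x).
  by apply: eq_Rintegral => w _; rewrite (K_psd w).1 Im_conj mulN1r.
have pairi (p : R[i] * T) := cintegral_sum _ u (fun q => q.1^*) (fun q => K q.2 p.2)
  (fun q => Ki q.2 p.2).
have [_ grami] := cintegral_sum _ u fst (fun p w => pairing ((K^~ p.2)^~ w) u)
  (fun p => (pairi p).1).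
rewrite [gram _ _ _](_ : _ = cintegral mu (fun w => gram (fun x y => K x y w) u u)).
  by apply: Rintegral_ge0 => w _; exact: (K_psd w).2.
by rewrite grami; apply: eq_bigr => p _; rewrite (pairi p).2.
Qed.

End IntegralOfKernels.

Theorem corollary4p3 (R : realType)
    (X : topologicalGroupType) (X_separable : separable_space X)
    (d : measure_display) (Omega : measurableType d)
    (mu : {measure set Omega -> \bar R})
    (phi : X -> Omega -> R[i])
    (phi_L2 : forall x : X, L2 mu (phi x))
    (phi_continuous : forall w : Omega,
       continuous ((fun x : X => phi x w) : X -> R[i]^o))
    (phi_posdef : forall w : Omega,
       positive_definite_function (fun x : X => phi x w))
    (* the integral defining psi exists at every point *)
    (phi_integrable : forall x : X, cintegrable mu (phi x)) :
  positive_definite_function (fun x : X => cintegral mu (phi x)).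
Proof.
apply: Moore_Aronszajn.
apply: (psd_integral mu X (fun x y => phi (x * y^-1)%g)) => // w.
exact: reproducing_kernel_psd (phi_posdef w).
Qed.
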